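(* Let $a\le x<x'\le b$ be real numbers, $0<\alpha\le\frac12$, $y=(1-\alpha)x+\alpha x'$, $y'=\alpha x+(1-\alpha)x'$. Let $f:[a,b]\to\mathbb{R}$ be convex and let $p:[x,x']\to[0,\infty)$ be integrable and symmetric about $\frac{x+x'}{2}$. Let $\mathrm{Jp}:[0,1]\to\mathbb{R}$ be the function defined in the context. Then $\mathrm{Jp}$ is convex and increasing on $[0,1]$, and for all $t\in[0,1]$ $$\left[f\left(\frac{x+y}{2}\right)+f\left(\frac{x'+y'}{2}\right)\right]\int_x^{x'}p(s)\,ds=\mathrm{Jp}(0)\le \mathrm{Jp}(t)\le \mathrm{Jp}(1)=\int_x^{x'}\left[f((1-\alpha)x+\alpha s)+f((1-\alpha)x'+\alpha s)\right]p(s)\,ds.$$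
   Context: Symmetric about $\frac{x+x'}{2}$ means $p(s)=p(x+x'-s)$ for $s\in[x,x']$. ''Increasing'' is meant in the weak (non-strict) sense. For $t\in[0,1]$ define $$\mathrm{Jp}(t)=\int_x^{x'}\left[f\left(t((1-\alpha)x+\alpha s)+(1-t)\frac{x+y}{2}\right)+f\left(t((1-\alpha)x'+\alpha s)+(1-t)\frac{x'+y'}{2}\right)\right]p(s)\,ds.$$ *)

(* Defs.v *)
From HB Require Import structures.
From mathcomp Require Import all_boot all_order all_algebra.
From mathcomp Require Import all_classical all_reals all_analysis.

Set Implicit Arguments.
Unset Strict Implicit.
Unset Printing Implicit Defensive.

Import Order.TTheory GRing.Theory Num.Theory.
Import numFieldNormedType.Exports.

Local Open Scope classical_set_scope.
Local Open Scope ring_scope.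

(* Integrals are with respect to the completed Lebesgue measure, so that the
   weights range over all Lebesgue-measurable functions: [lebesgue_measure] is
   restricted to Borel sets, and would even exclude some Riemann-integrable
   weights. *)
Notation leb := completed_lebesgue_measure.

(* Real functions on a closed interval are represented by total functions
   whose values outside the interval are unconstrained. *)
Definition symmetric_weight (R : realType) (x x' : R) (p : R -> R) : Prop :=
  {in `[x, x'], forall s, p s = p (x + x' - s)}.

Definition Jp (R : realType) (f p : R -> R) (alpha x x' y y' : R) (t : R) : R :=
  \int[leb]_(s in `[x, x'])
    ((f (t * ((1 - alpha) * x + alpha * s) + (1 - t) * ((x + y) / 2))
      + f (t * ((1 - alpha) * x' + alpha * s) + (1 - t) * ((x' + y') / 2)))
     * p s).

(* Main.v *)
(* With c = (x + y)/2, c' = (x' + y')/2, m = (x + x')/2 and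
   K v = f (c + alpha v) + f (c' + alpha v), one has
   Jp t = \int K (t (s - m)) p s ds, and this formula makes sense for all t in
   [-1, 1]. It is convex in t because K is convex and p >= 0, and even in t by
   the reflection s |-> x + x' - s, which preserves p and the measure. An even
   convex function on [-1, 1] increases on [0, 1]. *)
Require Import Defs.
From HB Require Import structures.
From mathcomp Require Import all_boot all_order all_algebra.
From mathcomp Require Import all_classical all_reals all_analysis.
From mathcomp Require Import measurable_realfun ring lra.

Set Implicit Arguments.
Unset Strict Implicit.
Unset Printing Implicit Defensive.

Import Order.TTheory GRing.Theory Num.Theory.
Import numFieldNormedType.Exports.

Local Open Scope classical_set_scope.
Local Open Scope ring_scope.

(* The domain of [leb]: the reals with the Lebesgue-measurable sets. *)
Notation lebT R := (caratheodory_type (@wlength R idfun)^*%mu).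

(** * Reflection invariance of the completed Lebesgue measure *)

Lemma preimage_subl_itvcc (R : realType) (c a b : R) :
  (fun s => c - s) @^-1` `[a, b] = `[c - b, c - a]%classic.
Proof.
apply/seteqP; split => s /=; rewrite !in_itv/= => /andP[h1 h2];
  by apply/andP; split; lra.
Qed.

Lemma preimage_subl_itvoc (R : realType) (c a b : R) :
  (fun s => c - s) @^-1` `]a, b] = `[c - b, c - a[%classic.
Proof.
apply/seteqP; split => s /=; rewrite !in_itv/= => /andP[h1 h2];
  by apply/andP; split; lra.
Qed.

Lemma measurable_fun_subl (R : realType) (c : R) :
  measurable_fun setT
    ((fun s => c - s) : measurableTypeR R -> measurableTypeR R).
Proof. by apply: measurable_funB. Qed.

(** By uniqueness of Lebesgue measure it suffices to compare the pushforward with it on intervals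
    []a, b]]. Reflection moves the open end to the other side and keeps the length. *)
Lemma lebesgue_measure_subl (R : realType) (c : R) (A : set R) :
  measurable A ->
  lebesgue_measure ((fun s => c - s) @^-1` A) = lebesgue_measure A.
Proof.
move=> mA; transitivity (pushforward lebesgue_measure
  ((fun s => c - s) : measurableTypeR R -> measurableTypeR R) A); first by [].
apply/esym/lebesgue_measure_unique => //=; first exact: measurable_fun_subl.
move=> mf _ [[a b]] _ <-.
rewrite /pushforward preimage_subl_itvoc !lebesgue_measure_itv/=.
rewrite !lte_fin ltrD2l ltrN2; case: ifP => // _.
by rewrite -!EFinB; congr EFin; ring.
Qed.

Lemma completed_lebesgue_measurableE (R : realType) :
  @measurable _ (lebT R) = completed_algebra_gen lebesgue_measure.
Proof.
rewrite -g_sigma_completed_algebra_genE.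
exact/esym/completed_caratheodory_measurable.
Qed.

(** A completed-measurable set is a Borel set [B] together with a subset [N] of a Borel null set
    [M]. Reflection preserves Borel sets and their measure, hence this decomposition. *)
Lemma completed_lebesgue_measurable_subl (R : realType) (c : R) :
  measurable_fun setT ((fun s => c - s) : lebT R -> lebT R).
Proof.
move=> _ /= A; rewrite setTI.
rewrite completed_lebesgue_measurableE => -[B mB [N [M [mM M0 NM]] <-]].
rewrite preimage_setU; exists ((fun s => c - s) @^-1` B).
  by rewrite -[X in measurable X]setTI; exact: measurable_fun_subl.
exists ((fun s => c - s) @^-1` N) => //.
exists ((fun s => c - s) @^-1` M); split.
- by rewrite -[X in measurable X]setTI; exact: measurable_fun_subl.
- by rewrite lebesgue_measure_subl.
- by move=> s; apply: NM.
Qed.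

Lemma completed_lebesgue_measure_subl (R : realType) (c : R) (A : set (lebT R)) :
  measurable A -> leb ((fun s => c - s) @^-1` A) = leb A.
Proof.
(* One inequality suffices: reflection is an involution, so applying it to the preimage of [A] gives
   the converse. *)
suff le (B : set (lebT R)) : measurable B ->
    (leb ((fun s : R => (c - s)%R) @^-1` B) <= leb B)%E.
  move=> mA; apply/eqP; rewrite eq_le le//=.
  have mfA : measurable ((fun s : lebT R => c - s : lebT R) @^-1` A).
    rewrite -[X in measurable X]setTI.
    exact: completed_lebesgue_measurable_subl.
  have := le _ mfA; congr (leb _ <= _)%E.
  by apply/funext => s /=; rewrite subKr.
rewrite completed_lebesgue_measurableE => -[A' mA [N [M [mM M0 NM]] <-]].
(* Enlarging [N] to the null set [M] makes the set Borel without exceeding the measure of [A']. Both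
   measures restrict the same outer measure, so monotonicity passes between them. *)
apply: (@le_trans _ _ (lebesgue_measure ((fun s => c - s) @^-1` (A' `|` M)))).
  by apply: le_outer_measure; apply: preimage_subset; exact: setUS.
rewrite lebesgue_measure_subl; last exact: measurableU.
apply: (@le_trans _ _ (lebesgue_measure A')).
  have := @measureU2 _ _ _ lebesgue_measure _ _ mA mM.
  by rewrite [X in (_ <= _ + X)%E -> _]M0 adde0.
by apply: le_outer_measure; exact: subsetUl.
Qed.

(** The left-hand side is the integral of [g] against the pushforward of [leb] under the reflection,
    and this pushforward agrees with [leb] on measurable sets. *)
Lemma ge0_integral_completed_subl (R : realType) (c : R) (D : set (lebT R))
    (g : lebT R -> \bar R) :
  measurable D -> measurable_fun D g -> (forall s, 0 <= g s)%E ->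
  (fun s : R => c - s) @^-1` D = D ->
  (\int[leb]_(s in D) g (c - s)%R = \int[leb]_(s in D) g s)%E.
Proof.
move=> mD mg g0 DE.
pose phi := (fun s => c - s) : lebT R -> lebT R.
have mphi : measurable_fun setT phi := completed_lebesgue_measurable_subl c.
transitivity (\int[pushforward leb phi]_(s in D) (g s))%E.
  by rewrite (ge0_integral_pushforward mphi)// {2}/phi DE.
apply: eq_measure_integral => A mA _.
exact: completed_lebesgue_measure_subl.
Qed.

Lemma integral_completed_subl (R : realType) (c : R) (D : set (lebT R))
    (g : lebT R -> \bar R) :
  measurable D -> measurable_fun D g -> (fun s : R => c - s) @^-1` D = D ->
  (\int[leb]_(s in D) g (c - s)%R = \int[leb]_(s in D) g s)%E.
Proof.
move=> mD mg DE; pose phi := (fun s => c - s) : lebT R -> lebT R.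
rewrite -[LHS]/(\int[leb]_(s in D) (g \o phi) s)%E.
rewrite [LHS]integralE [RHS]integralE funepos_comp funeneg_comp.
congr (_ - _)%E; apply: ge0_integral_completed_subl => //.
- exact: measurable_funepos.
- exact: measurable_funeneg.
Qed.

Lemma Rintegral_completed_subl (R : realType) (c : R) (D : set (lebT R))
    (g : lebT R -> R) :
  measurable D -> measurable_fun D g -> (fun s : R => c - s) @^-1` D = D ->
  \int[leb]_(s in D) g (c - s) = \int[leb]_(s in D) g s.
Proof.
move=> mD mg DE; congr fine.
exact/(integral_completed_subl mD _ DE)/measurable_EFinP.
Qed.

(** * Convex functions on a closed interval *)

Lemma convex_itvP (R : realType) (a b : R) (f : R -> R) :
  convex_function (`[a, b]%classic : set R) f <->
  {in `[a, b] &, forall u v l, 0 <= l <= 1 ->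
    f (l * u + (1 - l) * v) <= l * f u + (1 - l) * f v}.
Proof.
split => [cf u v uI vI l l01|cf l u v].
  have := cf (Itv01 (andP l01).1 (andP l01).2) u v.
  by rewrite !inE; apply.
rewrite !inE => uI vI; apply: cf => //.
by rewrite ge0/= le1.
Qed.

Lemma convex_itvcc (R : realType) (a b u v l : R) :
  u \in `[a, b] -> v \in `[a, b] -> 0 <= l <= 1 ->
  l * u + (1 - l) * v \in `[a, b].
Proof.
rewrite !in_itv/= => /andP[au ub] /andP[av vb] /andP[l0 l1].
by apply/andP; split; nra.
Qed.

Lemma itvcc_convex_combination (R : realType) (u v w : R) :
  w \in `[u, v] -> exists2 l, 0 <= l <= 1 & w = l * u + (1 - l) * v.
Proof.
rewrite in_itv/= => /andP[uw wv].
(* If [v <= u], the interval reduces to the point [w = v], and the weight [0] works. *)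
have [uv|vu] := ltP u v; last by exists 0; [rewrite lexx ler01|lra].
have uv0 : 0 < v - u by rewrite subr_gt0.
exists ((v - w) / (v - u)); last by field; rewrite gt_eqF.
by rewrite divr_ge0 ?subr_ge0 ?(ltW uv)//= ler_pdivrMr//; lra.
Qed.

Lemma convex_function_affine (R : realType) (a b c d k e : R) (f : R -> R) :
  convex_function (`[a, b]%classic : set R) f ->
  {in `[c, d], forall s, k * s + e \in `[a, b]} ->
  convex_function (`[c, d]%classic : set R) (fun s => f (k * s + e)).
Proof.
move=> /convex_itvP cf cdab; apply/convex_itvP => u v uI vI l l01.
rewrite (_ : _ + e = l * (k * u + e) + (1 - l) * (k * v + e)); last by ring.
by apply: cf => //; exact: cdab.
Qed.

Lemma convex_functionD (R : realType) (a b : R) (f g : R -> R) :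
  convex_function (`[a, b]%classic : set R) f ->
  convex_function (`[a, b]%classic : set R) g ->
  convex_function (`[a, b]%classic : set R) (fun s => f s + g s).
Proof.
move=> /convex_itvP cf /convex_itvP cg; apply/convex_itvP => u v uI vI l l01.
by have := cf _ _ uI vI _ l01; have := cg _ _ uI vI _ l01; lra.
Qed.

(** The chord between the endpoints bounds [f] above by [M]. For the lower bound, the midpoint of
    [s] and its reflection [a + b - s] is [(a + b) / 2], so [f s >= 2 * f ((a + b) / 2) - M]. *)
Lemma convex_function_bounded (R : realType) (a b : R) (f : R -> R) :
  convex_function (`[a, b]%classic : set R) f ->
  [bounded f s | s in `[a, b]%classic].
Proof.
move=> /convex_itvP cf; pose M := `|f a| + `|f b|.
have ub s : s \in `[a, b] -> f s <= M.
  move=> sI; have ab : a <= b.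
    by move: sI; rewrite in_itv/= => /andP[]; exact: le_trans.
  have [l /[dup] l01 /andP[l0 l1] ->] := itvcc_convex_combination sI.
  apply: (le_trans (cf _ _ _ _ _ l01)); rewrite ?in_itv/= ?lexx ?ab//.
  have := ler_norm (f a); have := ler_norm (f b).
  have := normr_ge0 (f a); have := normr_ge0 (f b).
  rewrite /M; nra.
suff bd s : s \in `[a, b] -> `|f s| <= 2 * `|f ((a + b) / 2)| + M.
  exists (2 * `|f ((a + b) / 2)| + M); split; first exact: num_real.
  by move=> N MN s /= sI; rewrite (le_trans (bd _ sI))// ltW.
move=> sI; have sI' : a + b - s \in `[a, b].
  by move: sI; rewrite !in_itv/= => /andP[h1 h2]; apply/andP; split; lra.
have half : 0 <= (1 / 2 : R) <= 1 by apply/andP; split; lra.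
have := cf _ _ sI sI' _ half.
rewrite (_ : _ * s + _ = (a + b) / 2); last by field.
have := ub _ sI; have := ub _ sI'.
have := ler_norm (- f ((a + b) / 2)); rewrite normrN.
have := normr_ge0 (f ((a + b) / 2)).
by rewrite ler_norml => *; apply/andP; split; lra.
Qed.

(** * Measurability and integrability of convex functions *)

Lemma completed_lebesgue_measurable_itv (R : realType) (i : interval R) :
  measurable ([set` i] : set (lebT R)).
Proof. by apply: sub_caratheodory; exact: measurable_itv. Qed.

(** A convex function may jump at the endpoints, so the argument goes through level sets instead of
    continuity. *)
Lemma convex_function_measurable (R : realType) (a b : R) (f : R -> R) :
  convex_function (`[a, b]%classic : set R) f ->
  measurable_fun (`[a, b]%classic : set (lebT R)) f.
Proof.
move=> /convex_itvP cf mD; apply: (measurability _ (RGenOInfty.measurableE R)) => //.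
move=> _ [_ [r ->] <-].
(* The preimage of a ray []r, +oo[] is the complement in [[a, b]] of a sublevel set. *)
rewrite (_ : _ `&` _ = `[a, b]%classic `\`
    [set s | s \in `[a, b] /\ f s <= r]); last first.
  apply/seteqP; split => s /= [sI].
    by rewrite in_itv/= andbT => rf; split => // -[_]; rewrite leNgt rf.
  move=> nf; split => //; rewrite in_itv/= andbT ltNge; apply/negP => fr.
  exact: nf.
(* Sublevel sets of a convex function are intervals. *)
apply: measurableD => //; apply: sub_caratheodory; apply: is_interval_measurable.
move=> u v [uI fu] [vI fv] w uwv.
have [l /[dup] l01 /andP[l0 l1] ->] := itvcc_convex_combination uwv.
split; first exact: convex_itvcc.
by apply: (le_trans (cf _ _ uI vI _ l01)); nra.
Qed.

(** A bounded measurable factor preserves integrability. *)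
Lemma convex_function_integrableM (R : realType) (a b : R) (f p : R -> R) :
  convex_function (`[a, b]%classic : set R) f ->
  leb.-integrable `[a, b] (EFin \o p) ->
  leb.-integrable `[a, b] (EFin \o (fun s => f s * p s)).
Proof.
move=> cf; apply: (integrableMr _ (convex_function_measurable cf)).
  exact: completed_lebesgue_measurable_itv.
exact: convex_function_bounded.
Qed.

(** For [0 <= s <= t], the point [s] is a convex combination of [- t] and [t], where [f] takes the
    common value [f t]. *)
Lemma convex_function_even_homo (R : realType) (b : R) (f : R -> R) :
  convex_function (`[- b, b]%classic : set R) f ->
  {in `[- b, b], forall s, f (- s) = f s} ->
  {in `[0, b] &, {homo f : s t / s <= t}}.
Proof.
move=> /convex_itvP cf ef s t; rewrite !in_itv/= => /andP[s0 sb] /andP[t0 tb] st.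
have tI : t \in `[- b, b] by rewrite in_itv/=; apply/andP; split; lra.
have tI' : - t \in `[- b, b] by rewrite in_itv/=; apply/andP; split; lra.
have sI : s \in `[- t, t] by rewrite in_itv/=; apply/andP; split; lra.
have [l l01 ->] := itvcc_convex_combination sI.
apply: (le_trans (cf _ _ tI' tI _ l01)); rewrite ef//; lra.
Qed.

Lemma convex_function_itvS (R : realType) (a b c d : R) (f : R -> R) :
  a <= c -> d <= b -> convex_function (`[a, b]%classic : set R) f ->
  convex_function (`[c, d]%classic : set R) f.
Proof.
move=> ac db cf t u v; rewrite !inE/= !in_itv/= => /andP[cu ud] /andP[cv vd].
by apply: cf; rewrite inE/= in_itv/=; apply/andP; split; lra.
Qed.

(** * Weighted averages of dilations of a convex function *)

Section dilated_average.
Context (R : realType) (x x' : R) (K p : R -> R).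
Let m : R := (x + x') / 2.
Let h : R := (x' - x) / 2.
Context (cK : convex_function (`[- h, h]%classic : set R) K).
Context (ip : leb.-integrable `[x, x'] (EFin \o p)).

Definition dilated_average (t : R) : R :=
  \int[leb]_(s in `[x, x']) (K (t * (s - m)) * p s).

(** Centring at the midpoint [m] sends [[x, x']] to the symmetric interval [[- h, h]], which is
    stable under factors of absolute value at most 1, negative ones included. *)
Let dilated_itv (t s : R) : t \in `[- 1, 1] -> s \in `[x, x'] ->
  t * (s - m) \in `[- h, h].
Proof.
rewrite !in_itv/= => /andP[t1 t2] /andP[s1 s2].
by rewrite /h /m; apply/andP; split; nra.
Qed.

Let dilated_integrable (t : R) : t \in `[- 1, 1] ->
  leb.-integrable `[x, x'] (EFin \o (fun s => K (t * (s - m)) * p s)).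
Proof.
move=> tI; apply: convex_function_integrableM => //.
have := @convex_function_affine _ _ _ x x' t (- (t * m)) _ cK.
rewrite (_ : (fun s => K (t * s - t * m)) =
    (fun s => K (t * (s - m)))); last first.
  by apply/funext => s; rewrite mulrBr.
apply=> s sI; rewrite -mulrBr; exact: dilated_itv.
Qed.

(** The integrand is convex in [t] for each fixed [s], because its argument is linear in [t] and
    [p s >= 0]; integration preserves the inequality. *)
Lemma convex_dilated_average : {in `[x, x'], forall s, 0 <= p s} ->
  convex_function (`[- 1, 1]%classic : set R) dilated_average.
Proof.
move=> p0; apply/convex_itvP => t u tI uI l l01.
have mD := @completed_lebesgue_measurable_itv R `[x, x'].
have it := dilated_integrable tI; have iu := dilated_integrable uI.
have itZ := integrableZl mD l it; have iuZ := integrableZl mD (1 - l) iu.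
rewrite /dilated_average -!RintegralZl// -RintegralD//.
apply: le_Rintegral => //.
- exact/dilated_integrable/convex_itvcc.
- exact: (integrableD mD itZ iuZ).
move=> s sI; rewrite !mulrA -mulrDl ler_wpM2r//; first exact: p0.
rewrite mulrDl -!mulrA; move/convex_itvP : cK; apply => //; exact: dilated_itv.
Qed.

Lemma dilated_averageN (t : R) : symmetric_weight x x' p -> t \in `[- 1, 1] ->
  dilated_average (- t) = dilated_average t.
Proof.
move=> sp tI; rewrite /dilated_average.
have mD := @completed_lebesgue_measurable_itv R `[x, x'].
have mg := measurable_int _ (dilated_integrable tI).
(* Since [x + x' - s - m = - (s - m)], reflecting the integral for [t] produces the one for
   [- t]. *)
rewrite -(@Rintegral_completed_subl _ (x + x') `[x, x']
  (fun s : R => K (t * (s - m)) * p s))//.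
- apply: eq_Rintegral => s; rewrite inE => sI.
  by rewrite -sp//; congr (K _ * _); rewrite /m; field.
- exact/measurable_EFinP.
- by rewrite preimage_subl_itvcc addrK (addrC x) addrK.
Qed.

End dilated_average.

Theorem theorem10 (R : realType) (a b x x' alpha y y' : R) (f p : R -> R)
    (hax : a <= x) (hxx' : x < x') (hx'b : x' <= b)
    (halpha0 : 0 < alpha) (halpha : alpha <= 1 / 2)
    (hy : y = (1 - alpha) * x + alpha * x')
    (hy' : y' = alpha * x + (1 - alpha) * x')
    (hf : convex_function (`[a, b]%classic : set R) f)
    (hp_ge0 : {in `[x, x'], forall s, 0 <= p s})
    (hp_int : leb.-integrable `[x, x'] (EFin \o p))
    (hp_sym : symmetric_weight x x' p) :
  let J := Jp f p alpha x x' y y' in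
  [/\ convex_function (`[0, 1]%classic : set R) J,
      {in `[0, 1] &, {homo J : s t / s <= t}}
    & forall t, t \in `[0, 1] ->
        [/\ (f ((x + y) / 2) + f ((x' + y') / 2))
              * \int[leb]_(s in `[x, x']) p s = J 0,
            J 0 <= J t,
            J t <= J 1
          & J 1 = \int[leb]_(s in `[x, x'])
                    ((f ((1 - alpha) * x + alpha * s)
                      + f ((1 - alpha) * x' + alpha * s)) * p s)]].
Proof.
move=> J.
(* By the formulas for [y] and [y'], the two arguments of [f] in [Jp] are [(x + y) / 2] and
   [(x' + y') / 2], each shifted by the same amount [alpha * (t * (s - m))] with
   [m = (x + x') / 2]. *)
pose K v := f (alpha * v + (x + y) / 2) + f (alpha * v + (x' + y') / 2).
have JE : J = dilated_average x x' K p.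
  apply/funext => t; rewrite /J /Jp; apply: eq_Rintegral => s _. rewrite /K hy hy'.
  by congr ((f _ + f _) * _); field.
(* On this interval the arguments of [f] in [K] run over [[x, y]] and [[y', x']], both contained in
   [[x, x']] and so in [[a, b]]. *)
have cK : convex_function (`[- ((x' - x) / 2), (x' - x) / 2]%classic : set R) K.
  apply: convex_functionD; apply: (convex_function_affine hf) => v;
  rewrite !in_itv/= ?hy ?hy' => /andP[v1 v2]; apply/andP; split; nra.
have cJ : convex_function (`[- 1, 1]%classic : set R) J.
  by rewrite JE; exact: convex_dilated_average.
have eJ : {in `[- 1, 1], forall t, J (- t) = J t}.
  by move=> t tI; rewrite JE dilated_averageN.
have hJ := convex_function_even_homo cJ eJ.
have I0 : 0 \in `[0 : R, 1] by rewrite in_itv/= lexx ler01.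
have I1 : 1 \in `[0 : R, 1] by rewrite in_itv/= lexx ler01.
split=> [|//|t /[dup] tI]; first by apply: convex_function_itvS cJ; lra.
rewrite in_itv/= => /andP[t0 t1]; split; [|exact: hJ|exact: hJ|].
(* At [t = 0] the factor multiplying [p s] does not depend on [s], so it comes out of the
   integral. *)
- rewrite -RintegralZl//; last exact: completed_lebesgue_measurable_itv.
  by apply: eq_Rintegral => s _; rewrite !mul0r !add0r subr0 !mul1r.
- by apply: eq_Rintegral => s _; rewrite subrr !mul0r !addr0 !mul1r.
Qed.
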